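(* Let $k\geq 3$ and $d\geq 2$ be integers. Then the groups $\ker(\widehat{\mathcal{Q}}_{k,d})$ and $\ker(\mathcal{Q}_{k,d})$ are not finitely generated.
   Context: For a free product of groups $L=L_1*\cdots*L_k$ (with this fixed decomposition), $\mathrm{SymAut}(L)$ is the group of symmetric automorphisms of $L$, i.e. the automorphisms of $L$ sending each $L_i$ to a conjugate of some $L_j$; $\mathrm{SymOut}(L)$ is the image of $\mathrm{SymAut}(L)$ in $\mathrm{Out}(L)$. The free group $F_k$ is regarded as the free product $\mathbb{Z}*\cdots*\mathbb{Z}$ of $k$ infinite cyclic groups (generated by a fixed basis), and $H_{k,d}=(\mathbb{Z}/d\mathbb{Z})*\cdots*(\mathbb{Z}/d\mathbb{Z})$ ($k$ factors). The natural surjection $F_k\to H_{k,d}$ (reducing each factor mod $d$) induces homomorphisms $\widehat{\mathcal{Q}}_{k,d}:\mathrm{SymAut}(F_k)\to\mathrm{SymAut}(H_{k,d})$ and $\mathcal{Q}_{k,d}:\mathrm{SymOut}(F_k)\to\mathrm{SymOut}(H_{k,d})$. *)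

(* Defs.v *)
From HB Require Import structures.
From mathcomp Require Import all_boot all_order all_algebra.
From mathcomp Require Import boolp classical_sets cardinality.

Set Implicit Arguments.
Unset Strict Implicit.
Unset Printing Implicit Defensive.

Local Open Scope classical_set_scope.
Local Open Scope group_scope.

Notation hom G H := (UMagmaMorphism.type G H).

Section Generation.
Variable G : groupType.
Implicit Types A S : set G.

Definition subgroup A := A 1 /\ forall x y, A x -> A y -> A (x / y).

Definition generated S : set G := smallest subgroup S.

Definition finitely_generated A := exists2 S, finite_set S & generated S = A.

End Generation.

Definition kernel (G H : groupType) (f : hom G H) : set G := [set x | f x = 1].

(* The free product of a family of groups is realized on reduced words:
   sequences of nontrivial letters, consecutive letters lying in distinct
   factors. *)
Section FreeProduct.
Variables (I : finType) (L : I -> groupType).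
Implicit Types (a b : {i : I & L i}) (s t u : seq {i : I & L i}).

Definition reduced s :=
  all (fun a => tagged a != 1) s && sorted (fun a b => tag a != tag b) s.

(* Product of a single letter, possibly trivial, and a reduced word. *)
Definition push a s :=
  if tagged a == 1 then s else
  if s is b :: s' then
    if tag a == tag b then
      let c := tagged a * tagged_as a b in
      if c == 1 then s' else Tagged L c :: s'
    else a :: s
  else [:: a].

Definition invl a := Tagged L (tagged a)^-1.

Lemma reduced_cons a s : reduced (a :: s) -> reduced s.
Proof.
rewrite /reduced /= => /andP[/andP[_ ->] /=].
exact: path_sorted.
Qed.

Lemma push_reduced_cons a s : reduced (a :: s) -> push a s = a :: s.
Proof.
rewrite /reduced /push /= => /andP[/andP[/negbTE-> _]].
by case: s => //= b s /andP[/negbTE->].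
Qed.

Lemma push_reduced a s : reduced s -> reduced (push a s).
Proof.
case: a => i x; rewrite /push /=; case: (eqVneq x 1) => // x1.
case: s => [|[j y] s] rs; first by rewrite /reduced /= x1.
rewrite /=; case: eqVneq => [eij|ij].
  subst j; rewrite tagged_asE.
  case: eqVneq => [_|xy]; first exact: reduced_cons rs.
  move: rs; rewrite /reduced /= xy => /andP[/andP[_ ->]] /=.
  by case: s.
by move: rs; rewrite /reduced /= x1 ij.
Qed.

Lemma push1 i s : push (Tagged L (1 : L i)) s = s.
Proof. by rewrite /push /= eqxx. Qed.

Lemma push_push i (x y : L i) s : reduced s ->
  push (Tagged L x) (push (Tagged L y) s) = push (Tagged L (x * y)) s.
Proof.
case: (eqVneq x 1) => [-> _|x1]; first by rewrite push1 mul1g.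
case: (eqVneq y 1) => [-> _|y1]; first by rewrite push1 mulg1.
case: s => [|[j z] s] rs.
  by rewrite /push /= (negbTE y1) /= (negbTE x1) eqxx tagged_asE.
case: (eqVneq i j) => [eij|ij].
  subst j; rewrite [push (Tagged L y) _]/push /= (negbTE y1) eqxx tagged_asE.
  case: (eqVneq (y * z) 1) => [yz|yz].
    have zE : z = y^-1 by apply/esym/mulg1_eq.
    have rxs : push (Tagged L x) s = Tagged L x :: s.
      apply: push_reduced_cons; move: rs; rewrite /reduced /= x1.
      by move=> /andP[/andP[_ ->]] /=; case: s.
    rewrite rxs /push /= eqxx tagged_asE zE mulgK (negbTE x1).
    case: eqVneq => // xy.
    congr (Tagged L _ :: s); apply/esym.
    by rewrite -[x](mulgK y) xy mul1g.
  rewrite /push /= (negbTE x1) eqxx !tagged_asE mulgA.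
  case: (eqVneq (x * y) 1) => [xy|xy] //.
  rewrite xy mul1g; case: eqVneq => // z1.
  by move: rs; rewrite z1 /reduced /= eqxx.
rewrite [push (Tagged L y) _]/push /= (negbTE y1) (negbTE ij).
rewrite /push /= (negbTE x1) eqxx tagged_asE (negbTE ij).
by case: eqVneq.
Qed.

Definition mulw s t := foldr push t s.

Lemma mulw_reduced s t : reduced t -> reduced (mulw s t).
Proof. by move=> rt; elim: s => //= a s; apply: push_reduced. Qed.

Lemma mulw_push a s u : reduced u -> mulw (push a s) u = push a (mulw s u).
Proof.
case: a => i x ru; case: (eqVneq x 1) => [->|x1]; first by rewrite !push1.
case: s => [|[j y] s]; first by rewrite {1}/push /= (negbTE x1).
rewrite [push _ (_ :: _)]/push /= (negbTE x1); case: eqVneq => [eij|//].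
subst j; rewrite tagged_asE push_push; last exact: mulw_reduced.
by case: eqVneq => [->|//]; rewrite push1.
Qed.

Lemma mulwA s t u : reduced u -> mulw s (mulw t u) = mulw (mulw s t) u.
Proof. by move=> ru; elim: s => //= a s ->; rewrite mulw_push. Qed.

Lemma mulw1 s : reduced s -> mulw s [::] = s.
Proof.
by elim: s => //= a s IH rs; rewrite IH ?push_reduced_cons ?(reduced_cons rs).
Qed.

Definition invw s := rev (map invl s).

Lemma invw_reduced s : reduced s -> reduced (invw s).
Proof.
rewrite /reduced /invw all_rev all_map rev_sorted sorted_map => /andP[As Ss].
apply/andP; split.
  by apply: sub_all As => a /=; rewrite invg_eq1.
apply: sub_sorted Ss => -[i x] [j y] /=.
by rewrite eq_sym.
Qed.

Lemma mulVw s : reduced s -> mulw (invw s) s = [::].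
Proof.
elim: s => // -[i x] s IH rs; rewrite /mulw /invw /= rev_cons foldr_rcons.
rewrite /invl /push /= eqxx tagged_asE mulVg eqxx.
case: eqVneq => [/eqP|_]; last exact/IH/(reduced_cons rs).
by rewrite invg_eq1 => /eqP x1; move: rs; rewrite x1 /reduced /= eqxx.
Qed.

Lemma invwK : involutive invw.
Proof.
move=> s; rewrite /invw map_rev revK -map_comp -[RHS]map_id.
by apply: eq_map => -[i x]; rewrite /= /invl /= invgK.
Qed.

Record freeprod := FreeProd { word :> seq {i : I & L i}; _ : reduced word }.

HB.instance Definition _ := [isSub of freeprod for word].
HB.instance Definition _ := [Choice of freeprod by <:].

Definition fp_one : freeprod := @FreeProd [::] isT.
Definition fp_mul (x y : freeprod) : freeprod :=
  FreeProd (mulw_reduced x (valP y)).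
Definition fp_inv (x : freeprod) : freeprod :=
  FreeProd (invw_reduced (valP x)).

Lemma fp_mulA : associative fp_mul.
Proof. by move=> x y z; apply/val_inj/mulwA/(valP z). Qed.
Lemma fp_mul1 : left_id fp_one fp_mul.
Proof. by move=> x; apply/val_inj. Qed.
Lemma fp_mulr1 : right_id fp_one fp_mul.
Proof. by move=> x; apply/val_inj/mulw1/(valP x). Qed.
Lemma fp_mulV : left_inverse fp_one fp_inv fp_mul.
Proof. by move=> x; apply/val_inj/mulVw/(valP x). Qed.
Lemma fp_mulrV : right_inverse fp_one fp_inv fp_mul.
Proof.
move=> x; apply/val_inj; rewrite /= -{1}[word x]invwK.
exact/mulVw/invw_reduced/(valP x).
Qed.

HB.instance Definition _ :=
  isGroup.Build freeprod fp_mulA fp_mul1 fp_mulr1 fp_mulV fp_mulrV.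

Definition fpinj i (x : L i) : freeprod :=
  FreeProd (push_reduced (Tagged L x) (isT : reduced [::])).

Lemma fpinj_morph i : monoid_morphism (@fpinj i).
Proof.
split=> [|x y]; apply/val_inj; first by rewrite /= push1.
change (push (Tagged L (x * y)) [::] =
  mulw (push (Tagged L x) [::]) (push (Tagged L y) [::])).
by rewrite mulw_push ?push_reduced //= push_push.
Qed.

HB.instance Definition _ i :=
  isUMagmaMorphism.Build (L i) freeprod (@fpinj i) (fpinj_morph i).

Lemma freeprodE (x : freeprod) : x = \prod_(a <- word x) fpinj (tagged a).
Proof.
apply/val_inj; case: x => s /= rs.
elim: s rs => [|a s IH] rs; first by rewrite big_nil.
rewrite big_cons [RHS]/= mulw_push; last by case: (\prod_(_ <- s) _).
by rewrite /= -IH ?(reduced_cons rs) // push_reduced_cons //; case: a rs.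
Qed.

Lemma hom_ext (G : groupType) (f g : hom freeprod G) :
  (forall i (x : L i), f (fpinj x) = g (fpinj x)) -> f =1 g.
Proof.
move=> fg x; rewrite [x]freeprodE !gmulf_prod.
by apply: eq_bigr => a _; apply: fg.
Qed.

Section Lift.
Variables (G : groupType) (f : forall i, hom (L i) G).

Definition fplift (x : freeprod) : G :=
  \prod_(a <- word x) f (tag a) (tagged a).

Lemma fplift_push a s :
  \prod_(b <- push a s) f (tag b) (tagged b)
  = f (tag a) (tagged a) * \prod_(b <- s) f (tag b) (tagged b).
Proof.
case: a => i x; case: (eqVneq x 1) => [->|x1].
  by rewrite push1 /= gmulf1 mul1g.
rewrite /push /= (negbTE x1); case: s => [|[j y] s].
  by rewrite big_cons.
rewrite big_cons /=; case: (eqVneq i j) => [eij|//]; last by rewrite !big_cons.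
subst j; rewrite tagged_asE mulgA -gmulfM.
by case: eqVneq => [->|_]; rewrite ?gmulf1 ?mul1g // big_cons.
Qed.

Lemma fplift_morph : monoid_morphism fplift.
Proof.
split=> [|x y]; first by rewrite /fplift big_nil.
rewrite /fplift /=; elim: (word x) => /= [|a s IH]; first by rewrite big_nil mul1g.
by rewrite fplift_push IH big_cons mulgA.
Qed.

HB.instance Definition _ :=
  isUMagmaMorphism.Build freeprod G fplift fplift_morph.

Lemma fplift_inj i (x : L i) : fplift (fpinj x) = f i x.
Proof. by rewrite /fplift fplift_push big_nil mulg1. Qed.

End Lift.

End FreeProduct.

Arguments fpinj {I L} i x.

Definition fpmap (I : finType) (L M : I -> groupType)
    (h : forall i, hom (L i) (M i)) : hom (freeprod L) (freeprod M) :=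
  fplift (fun i => fpinj i \o h i : hom (L i) (freeprod M)).

Section Automorphisms.
Variable G : groupType.

Definition automorphism (f : G -> G) := monoid_morphism f /\ bijective f.

Record Aut := MkAut { aut_val :> G -> G; _ : `[< automorphism aut_val >] }.

HB.instance Definition _ := [isSub of Aut for aut_val].
HB.instance Definition _ := [Choice of Aut by <:].

Lemma autP (f : Aut) : automorphism f.
Proof. exact/asboolP/(valP f). Qed.

HB.instance Definition _ (f : Aut) :=
  isUMagmaMorphism.Build G G (aut_val f) (autP f).1.

Lemma autE (f g : Aut) : f =1 g -> f = g.
Proof. by move=> fg; apply/val_inj/funext. Qed.

Lemma aut_one_subproof : automorphism (@id G).
Proof. by split; [split | exists id]. Qed.
Definition aut_one : Aut := MkAut (asboolT aut_one_subproof).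

Lemma aut_mul_subproof (f g : Aut) : automorphism (f \o g).
Proof.
split; last exact: bij_comp (autP f).2 (autP g).2.
by split=> [|x y] /=; rewrite ?gmulf1 // !gmulfM.
Qed.
Definition aut_mul (f g : Aut) : Aut := MkAut (asboolT (aut_mul_subproof f g)).

Lemma aut_inv_subproof (f : Aut) :
  exists g : Aut, cancel f g /\ cancel g f.
Proof.
have [_ [g fK gK]] := autP f.
have ag : automorphism g.
  split; last by exists f.
  by split=> [|x y]; [exact: can2_gmulf1 fK gK | exact: can2_gmulfM fK gK x y].
by exists (MkAut (asboolT ag)).
Qed.
Definition aut_inv (f : Aut) : Aut := projT1 (cid (aut_inv_subproof f)).

Lemma aut_invK (f : Aut) : cancel f (aut_inv f) /\ cancel (aut_inv f) f.
Proof. exact: projT2 (cid (aut_inv_subproof f)). Qed.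

Lemma aut_mulA : associative aut_mul.
Proof. by move=> f g h; apply: autE. Qed.
Lemma aut_mul1 : left_id aut_one aut_mul.
Proof. by move=> f; apply: autE. Qed.
Lemma aut_mulr1 : right_id aut_one aut_mul.
Proof. by move=> f; apply: autE. Qed.
Lemma aut_mulV : left_inverse aut_one aut_inv aut_mul.
Proof. by move=> f; apply: autE => x /=; rewrite (aut_invK f).1. Qed.
Lemma aut_mulrV : right_inverse aut_one aut_inv aut_mul.
Proof. by move=> f; apply: autE => x /=; rewrite (aut_invK f).2. Qed.

HB.instance Definition _ :=
  isGroup.Build Aut aut_mulA aut_mul1 aut_mulr1 aut_mulV aut_mulrV.

Lemma autKV (f : Aut) : cancel f f^-1. Proof. exact: (aut_invK f).1. Qed.
Lemma autVK (f : Aut) : cancel f^-1 f. Proof. exact: (aut_invK f).2. Qed.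

Lemma inner_subproof (x : G) : automorphism (fun y => x * y * x^-1).
Proof.
split; first by split=> [|y z]; rewrite ?mulg1 ?mulgV // !mulgA mulgVK.
by exists (fun y => x^-1 * y * x) => y; rewrite !mulgA ?mulVg ?mulgV ?mul1g
  -!mulgA ?mulVg ?mulgV mulg1.
Qed.
Definition inner (x : G) : Aut := MkAut (asboolT (inner_subproof x)).

Lemma inner_morph : monoid_morphism inner.
Proof.
split=> [|x y]; apply: autE => z /=; first by rewrite mul1g invg1 mulg1.
by rewrite invgM !mulgA.
Qed.
HB.instance Definition _ := isUMagmaMorphism.Build G Aut inner inner_morph.

Lemma aut_inner (f : Aut) x : f * inner x = inner (f x) * f.
Proof. by apply: autE => y /=; rewrite !gmulfM gmulfV. Qed.

Lemma innerK (x : G) : cancel (inner x) (inner x^-1).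
Proof. by move=> y; rewrite /= invgK !mulgA mulVg mul1g mulgVK. Qed.

Lemma aut_innerE (f : Aut) x y : f (inner (f^-1 x) y) = inner x (f y).
Proof. by rewrite /= !gmulfM gmulfV /= autVK. Qed.

(* [Out] is the quotient of [Aut] by the inner automorphisms. *)
Definition Out_rel (f g : Aut) : bool := `[< exists x, f = inner x * g >].

Lemma Out_rel_equiv : equiv_class_of Out_rel.
Proof.
split=> [f|f g|g f h].
- by apply/asboolP; exists 1; rewrite gmulf1 mul1g.
- by apply/asboolP/asboolP => -[x ->]; exists x^-1; rewrite gmulfV mulKg.
- move=> /asboolP[x ->] /asboolP[y ->]; apply/asboolP; exists (x * y).
  by rewrite gmulfM mulgA.
Qed.
Canonical Out_equiv := EquivRelPack Out_rel_equiv.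

Definition Out := {eq_quot Out_rel}%qT.
HB.instance Definition _ := Choice.on Out.

Definition to_Out (f : Aut) : Out := (\pi_Out f)%qT.

Lemma to_OutP f g : reflect (exists x, f = inner x * g) (to_Out f == to_Out g).
Proof. by apply: (iffP idP); rewrite /to_Out eqmodE => /asboolP. Qed.

Definition Out_one : Out := to_Out 1.
Definition Out_mul (y z : Out) : Out := to_Out (repr y * repr z).
Definition Out_inv (y : Out) : Out := to_Out (repr y)^-1.

Lemma to_Out_repr y : to_Out (repr y) = y. Proof. exact: reprK. Qed.

Lemma to_OutM f g : to_Out (f * g) = Out_mul (to_Out f) (to_Out g).
Proof.
apply/eqP/to_OutP.
have /eqP/to_OutP[x ->] := to_Out_repr (to_Out f).
have /eqP/to_OutP[y ->] := to_Out_repr (to_Out g).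
exists (f y^-1 * x^-1).
rewrite -!mulgA (mulgA f) aut_inner !mulgA -!gmulfM gmulfV mulgVK mulVg.
by rewrite gmulf1 mul1g.
Qed.

Lemma to_OutV f : to_Out f^-1 = Out_inv (to_Out f).
Proof.
apply/eqP/to_OutP.
have /eqP/to_OutP[x ->] := to_Out_repr (to_Out f).
by exists (f^-1 x); rewrite invgM -gmulfV mulgA -aut_inner -mulgA -gmulfM mulgV
  gmulf1 mulg1.
Qed.

Lemma Out_mulA : associative Out_mul.
Proof.
move=> x y z; rewrite -(to_Out_repr x) -(to_Out_repr y) -(to_Out_repr z).
by rewrite -!to_OutM mulgA.
Qed.
Lemma Out_mul1 : left_id Out_one Out_mul.
Proof. by move=> x; rewrite -(to_Out_repr x) -to_OutM mul1g. Qed.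
Lemma Out_mulr1 : right_id Out_one Out_mul.
Proof. by move=> x; rewrite -(to_Out_repr x) -to_OutM mulg1. Qed.
Lemma Out_mulV : left_inverse Out_one Out_inv Out_mul.
Proof. by move=> x; rewrite -(to_Out_repr x) -to_OutV -to_OutM mulVg. Qed.
Lemma Out_mulrV : right_inverse Out_one Out_inv Out_mul.
Proof. by move=> x; rewrite -(to_Out_repr x) -to_OutV -to_OutM mulgV. Qed.

HB.instance Definition _ :=
  isGroup.Build Out Out_mulA Out_mul1 Out_mulr1 Out_mulV Out_mulrV.

Lemma to_Out_morph : monoid_morphism to_Out.
Proof. by split=> // f g; exact: to_OutM. Qed.
HB.instance Definition _ := isUMagmaMorphism.Build Aut Out to_Out to_Out_morph.

End Automorphisms.

Section Symmetric.
Variables (I : finType) (L : I -> groupType).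
Local Notation F := (freeprod L).

Definition symmetric_aut (f : Aut F) := forall i, exists j w,
  f @` range (fpinj i) = inner w @` range (fpinj j).

Lemma fpinj_inj i : injective (@fpinj I L i).
Proof.
move=> x y /(congr1 (@word _ _)); rewrite /= /push /=.
case: (eqVneq x 1) => [->|x1]; case: (eqVneq y 1) => [->|y1] // [] /eqP.
by rewrite -tag_eqE /tag_eq /= eqxx tagged_asE => /eqP.
Qed.

Lemma fpinj_conj i j (x : L i) (y : L j) (v w : F) :
  inner v (fpinj i x) = inner w (fpinj j y) -> x != 1 -> i = j.
Proof.
pose h k : L k -> L i := if k =P i is ReflectT e
  then fun z => ecast l (L l) e z else fun=> 1.
have hM k : monoid_morphism (h k).
  rewrite /h; case: eqP => [e|_]; first by case: _ / e; split.
  by split=> [|z z'] //=; rewrite mulg1.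
pose hh k : hom (L k) (L i) :=
  HB.pack (h k) (isUMagmaMorphism.Build _ _ _ (hM k)).
move=> /(congr1 (fplift hh)) /= e x1; apply: contraNeq x1 => ij.
move: e; rewrite !gmulfM !gmulfV /= !fplift_inj /=.
have -> : h i x = x by rewrite /h; case: eqP => // e; rewrite (eq_irrelevance e erefl).
have -> : h j y = 1 by rewrite /h; case: eqP => // e; rewrite e eqxx in ij.
rewrite mulg1 mulgV => /(congr1 (fun z => z ^ fplift hh v)).
by rewrite conj1g /conjg !mulgA mulVg mul1g mulgVK => ->.
Qed.

Lemma symmetric1 : symmetric_aut 1.
Proof.
by move=> i; exists i, 1; apply: eq_imagel => x _ /=; rewrite mul1g invg1 mulg1.
Qed.

Lemma symmetricM f g :
  symmetric_aut f -> symmetric_aut g -> symmetric_aut (f * g).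
Proof.
move=> sf sg i; have [j [w e]] := sg i; have [l [v e']] := sf j.
exists l, (f w * v).
have -> : (f * g : Aut F) @` range (fpinj i) = f @` (g @` range (fpinj i)).
  by rewrite (image_comp g f).
have -> : inner (f w * v) @` range (fpinj l)
    = inner (f w) @` (inner v @` range (fpinj l)).
  by rewrite (image_comp (inner v) (inner (f w))) gmulfM.
rewrite e -e' (image_comp (inner w) f) (image_comp f (inner (f w))).
apply: eq_imagel => x _ /=.
by rewrite !gmulfM gmulfV.
Qed.

Lemma symmetricV f : symmetric_aut f -> symmetric_aut f^-1.
Proof.
move=> sf; pose N i := `[< exists x : L i, x != 1 >].
have [s sP] := choice sf.
pose t i := if N i then s i else i.
have sN i : N i -> N (s i).
  move=> /asboolP[x x1]; have [w e] := sP i.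
  have : (f @` range (fpinj i)) (f (fpinj i x)) by exists (fpinj i x) => //; exists x.
  rewrite e => -[_ [y _ <-]] /esym fx; apply/asboolP; exists y.
  apply: contraNneq x1 => y1; move: fx; rewrite y1 !gmulf1.
  move=> /(canRL (autKV f)); rewrite gmulf1 => ix.
  by apply/eqP/fpinj_inj; rewrite ix gmulf1.
have tI : injective t.
  move=> i j; rewrite /t; case: ifP => Ni; case: ifP => Nj // e; first last.
  - by rewrite e sN in Ni.
  - by rewrite -e sN in Nj.
  have /asboolP[x x1] := Ni; have [wi ei] := sP i; have [wj] := sP j.
  rewrite -e => ej.
  have : (f @` range (fpinj i)) (f (fpinj i x)) by exists (fpinj i x) => //; exists x.
  rewrite ei => -[_ [y _ <-]] /(canRL (innerK _)) fx.
  have : (f @` range (fpinj j)) (inner wj (fpinj (s i) y)).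
    by rewrite ej; exists (fpinj (s i) y) => //; exists y.
  move=> [_ [z _ <-]] /esym /(canRL (innerK _)) fz.
  move: fx; rewrite fz -!aut_innerE => /(can_inj (autKV f)).
  by move=> /esym/fpinj_conj; apply.
move=> j; exists (invF tI j); set i := invF tI j.
have : t i = j by apply: f_invF.
rewrite /t; case: ifP => [_ <-|/negP Ni <-].
  have [w e] := sP i; exists (f^-1 w^-1).
  have -> : range (fpinj (s i)) = inner w^-1 @` (f @` range (fpinj i)).
    rewrite e (image_comp (inner w)) -[LHS]image_id; apply: eq_imagel => x _.
    by rewrite /comp innerK.
  rewrite (image_comp f (inner w^-1)) (image_comp (inner w^-1 \o f) f^-1).
  apply: eq_imagel => x _.
  by rewrite /comp -aut_innerE autKV.
have L1 (x : L i) : fpinj i x = 1.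
  suff -> : x = 1 by rewrite gmulf1.
  by apply: contra_notP Ni => /eqP x1; apply/asboolP; exists x.
exists 1; apply: eq_imagel => _ [x _ <-].
by rewrite L1 !gmulf1.
Qed.

Lemma symmetric_aut_closed :
  group_closed (fun f : Aut F => `[< symmetric_aut f >]).
Proof.
split=> [|f g]; first by apply/asboolP; exact: symmetric1.
move=> /asboolP sf /asboolP sg; apply/asboolP.
by apply: symmetricM => //; exact: symmetricV.
Qed.

Record SymAut :=
  MkSymAut { symaut_val :> Aut F; _ : `[< symmetric_aut symaut_val >] }.

HB.instance Definition _ := [isSub of SymAut for symaut_val].
HB.instance Definition _ := [Choice of SymAut by <:].
HB.instance Definition _ :=
  SubChoice_isSubGroup.Build (Aut F) (fun f => `[< symmetric_aut f >]) SymAut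
    symmetric_aut_closed.

Lemma symaut_val_morph : monoid_morphism symaut_val.
Proof. by split=> [|f g]; rewrite -[symaut_val]/val ?val1 ?valM. Qed.
HB.instance Definition _ :=
  isUMagmaMorphism.Build SymAut (Aut F) symaut_val symaut_val_morph.

Lemma symautP (f : SymAut) : symmetric_aut f.
Proof. exact/asboolP/(valP f). Qed.

Definition symmetric_out (y : Out F) := exists f : SymAut, to_Out f = y.

Lemma symmetric_out_closed :
  group_closed (fun y : Out F => `[< symmetric_out y >]).
Proof.
split=> [|y z]; first by apply/asboolP; exists 1; rewrite !gmulf1.
move=> /asboolP[f <-] /asboolP[g <-]; apply/asboolP; exists (f / g).
by rewrite !gmulfF.
Qed.

Record SymOut :=
  MkSymOut { symout_val :> Out F; _ : `[< symmetric_out symout_val >] }.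

HB.instance Definition _ := [isSub of SymOut for symout_val].
HB.instance Definition _ := [Choice of SymOut by <:].
HB.instance Definition _ :=
  SubChoice_isSubGroup.Build (Out F) (fun y => `[< symmetric_out y >]) SymOut
    symmetric_out_closed.

Lemma symout_val_morph : monoid_morphism symout_val.
Proof. by split=> [|y z]; rewrite -[symout_val]/val ?val1 ?valM. Qed.
HB.instance Definition _ :=
  isUMagmaMorphism.Build SymOut (Out F) symout_val symout_val_morph.

Lemma symoutP (y : SymOut) : exists f : SymAut, to_Out f = y.
Proof. exact/asboolP/(valP y). Qed.

End Symmetric.

Section Reduction.
Variables k d : nat.

(* The additive groups of the integers and of the integers mod d, written
   multiplicatively.  The type ['Z_d] is the ring of integers mod d only for
   [1 < d]. *)
Local Notation Z := (Algebra.to_multiplicative int).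
Local Notation Zd := (Algebra.to_multiplicative 'Z_d).

Local Notation Zs := (fun _ : 'I_k => Z).
Local Notation Zds := (fun _ : 'I_k => Zd).

Definition Fk : groupType := freeprod Zs.
Definition Hkd : groupType := freeprod Zds.

Definition modd (z : Z) : Zd := (z%:~R)%R.
Lemma modd_morph : monoid_morphism modd.
Proof. by split=> // x y; exact: (GRing.rmorphD intr). Qed.
HB.instance Definition _ := isUMagmaMorphism.Build Z Zd modd modd_morph.

Definition reduction : hom Fk Hkd := fpmap (fun _ : 'I_k => modd : hom Z Zd).

Lemma Z_expg (x : Z) n : x ^+ n = GRing.natmul (x : int) n.
Proof. reflexivity. Qed.

Lemma Zd_expg (x : Zd) n : x ^+ n = GRing.natmul (x : 'Z_d) n.
Proof. reflexivity. Qed.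

Lemma modd_eq1 (z : Z) : modd z = 1 -> exists q : Z, z = q ^+ (Zp_trunc d).+2.
Proof.
have nat_case n : (n%:R)%R = 0%R :> 'Z_d ->
    exists q, n = (q * (Zp_trunc d).+2)%N.
  rewrite Zp_nat => /(congr1 val) /= /eqP nd.
  by exists (n %/ (Zp_trunc d).+2); rewrite divnK.
case: z => n.
  move=> /nat_case[q ->]; exists (Posz q).
  by rewrite [RHS]Z_expg -GRing.mulr_natr natz PoszM.
rewrite NegzE /modd GRing.rmorphN => n1.
have /nat_case[q ->] : ((n.+1)%:R = 0 :> 'Z_d)%R.
  by apply/eqP; rewrite -GRing.oppr_eq0; apply/eqP.
by exists (- Posz q)%R; rewrite [RHS]Z_expg -GRing.mulr_natr natz PoszM
  GRing.mulNr.
Qed.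

Lemma modd_surj (x : Zd) : exists z : Z, modd z = x.
Proof. by exists (Posz x); exact: natr_Zp. Qed.

Lemma reduction_inj (i : 'I_k) z : reduction (fpinj i z) = fpinj i (modd z).
Proof. exact: fplift_inj. Qed.

Lemma reduction_surj (y : Hkd) : exists x, reduction x = y.
Proof.
rewrite [y]freeprodE; elim: (word y) => [|[i a] s [x IH]].
  by exists 1; rewrite big_nil gmulf1.
have [z za] := modd_surj a; exists (fpinj i z * x).
by rewrite big_cons gmulfM IH reduction_inj za.
Qed.

Lemma reduction_inner w x :
  reduction (inner w x) = inner (reduction w) (reduction x).
Proof. by rewrite /= !gmulfM gmulfV. Qed.

Lemma reduction_symaut_ker (f : SymAut Zs) i (z : Z) :
  modd z = 1 -> reduction (f (fpinj i z)) = 1.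
Proof.
move=> /modd_eq1[q ->]; have [j [w e]] := symautP f i.
have : (f @` range (fpinj i)) (f (fpinj i q)) by exists (fpinj i q) => //; exists q.
rewrite e => -[_ [y _ <-]] fq.
have -> : f (fpinj i (q ^+ (Zp_trunc d).+2)) = f (fpinj i q) ^+ (Zp_trunc d).+2.
  by rewrite !gmulfXn.
rewrite -fq gmulfXn reduction_inner reduction_inj.
have -> : inner (reduction w) (fpinj j (modd y)) ^+ (Zp_trunc d).+2
    = inner (reduction w) (fpinj j (modd y ^+ (Zp_trunc d).+2)).
  by rewrite !gmulfXn.
have -> : modd y ^+ (Zp_trunc d).+2 = 1.
  rewrite Zd_expg -GRing.mulr_natr Zp_nat.
  have -> : inZp (Zp_trunc d).+2 = 0%R :> 'Z_d by apply/val_inj; rewrite /= modnn.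
  by rewrite GRing.mulr0.
by rewrite !gmulf1.
Qed.

Lemma reduction_symaut_modd (f : SymAut Zs) i (z z' : Z) :
  modd z = modd z' -> reduction (f (fpinj i z)) = reduction (f (fpinj i z')).
Proof.
move=> e; apply/divg1_eq; rewrite -!gmulfF; apply: reduction_symaut_ker.
by rewrite gmulfF /= e mulgV.
Qed.

(* Existence of the induced endomorphism, from the universal property of the
   free product. *)
Lemma induced_hom (f : SymAut Zs) :
  exists g : hom Hkd Hkd, forall x, g (reduction x) = reduction (f x).
Proof.
have [r rK] := choice modd_surj.
pose h i (m : Zd) : Hkd := reduction (f (fpinj i (r m))).
have hE i z : h i (modd z) = reduction (f (fpinj i z)).
  by apply: reduction_symaut_modd; rewrite rK.
have hM i : monoid_morphism (h i).
  split=> [|x y].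
    have <- : modd 1 = 1 by rewrite gmulf1.
    by rewrite hE !gmulf1.
  have <- : modd (r x * r y) = x * y by rewrite gmulfM /= !rK.
  by rewrite hE !gmulfM.
pose hh i : hom Zd Hkd := HB.pack (h i) (isUMagmaMorphism.Build _ _ _ (hM i)).
exists (fplift hh).
apply: (@hom_ext _ _ _ (fplift hh \o reduction) (reduction \o f)) => i x.
by rewrite /= reduction_inj fplift_inj /= hE.
Qed.

Lemma reduction_SymAut_subproof (f : SymAut Zs) :
  exists g : SymAut Zds,
    forall x, g (reduction x) = reduction (f x).
Proof.
have [g gE] := induced_hom f; have [g' g'E] := induced_hom f^-1.
have fK : cancel f (f^-1 : SymAut _).
  by move=> x; rewrite (gmulfV (symaut_val (L := fun _ => Z))) autKV.
have fVK : cancel (f^-1 : SymAut _) f.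
  by move=> x; rewrite (gmulfV (symaut_val (L := fun _ => Z))) autVK.
have ag : automorphism g.
  split; first by split=> [|x y]; rewrite ?gmulf1 ?gmulfM.
  by exists g' => y; have [x <-] := reduction_surj y;
    rewrite ?gE ?g'E ?gE ?g'E ?fK ?fVK.
have sg : symmetric_aut (MkAut (asboolT ag)).
  move=> i; have [j [w e]] := symautP f i; exists j, (reduction w).
  have RR l : range (fpinj l : Zd -> Hkd) = reduction @` range (fpinj l : Z -> Fk).
    apply/seteqP; split => [_ [x _ <-]|_ [_ [x _ <-] <-]].
      have [z <-] := modd_surj x; exists (fpinj l z); first by exists z.
      exact: reduction_inj.
    by exists (modd x) => //; rewrite reduction_inj.
  rewrite !RR (image_comp reduction) (image_comp reduction (inner _)).
  transitivity (reduction @` (f @` range (fpinj i))).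
    by rewrite (image_comp f reduction); apply: eq_imagel => x _; exact: gE.
  rewrite e (image_comp (inner w) reduction); apply: eq_imagel => x _.
  exact: reduction_inner.
by exists (MkSymAut (asboolT sg)).
Qed.

(* The automorphism induced by f is unique, since [reduction] is onto. *)
Definition Qhat_fun f := projT1 (cid (reduction_SymAut_subproof f)).

Lemma Qhat_funE (f : SymAut Zs) x :
  Qhat_fun f (reduction x) = reduction (f x).
Proof. exact: projT2 (cid (reduction_SymAut_subproof f)) x. Qed.

Lemma Qhat_uniq (f : SymAut Zs) (g : SymAut Zds) :
  (forall x, g (reduction x) = reduction (f x)) -> Qhat_fun f = g.
Proof.
move=> gE; apply/val_inj/autE => y; have [x <-] := reduction_surj y.
by rewrite gE -Qhat_funE.
Qed.

Lemma Qhat_morph : monoid_morphism Qhat_fun.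
Proof.
split=> [|f g]; first exact: Qhat_uniq.
by apply: Qhat_uniq => x /=; rewrite !Qhat_funE.
Qed.
HB.instance Definition _ :=
  isUMagmaMorphism.Build (SymAut Zs) (SymAut Zds) Qhat_fun Qhat_morph.

Definition Qhat : hom (SymAut Zs) (SymAut Zds) := Qhat_fun.

Lemma QhatE (f : SymAut Zs) x : Qhat f (reduction x) = reduction (f x).
Proof. exact: Qhat_funE. Qed.

Lemma Qhat_out (f g : SymAut Zs) :
  to_Out f = to_Out g -> to_Out (Qhat f) = to_Out (Qhat g).
Proof.
move=> /eqP/to_OutP[w fE]; apply/eqP/to_OutP; exists (reduction w).
apply: autE => y; have [x <-] := reduction_surj y.
by rewrite QhatE fE /= !gmulfM gmulfV QhatE.
Qed.

Lemma Q_subproof (y : SymOut Zs) :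
  exists z : SymOut Zds,
    forall f : SymAut Zs, to_Out f = y -> to_Out (Qhat f) = z.
Proof.
have [g gy] := symoutP y.
have sg : symmetric_out (to_Out (Qhat g)) by exists (Qhat g).
exists (MkSymOut (asboolT sg)) => f fy.
by apply: Qhat_out; rewrite fy.
Qed.

(* The class of [Qhat f] for any symmetric representative f of y. *)
Definition Q_fun (y : SymOut Zs) : SymOut Zds := projT1 (cid (Q_subproof y)).

Lemma Q_funE (y : SymOut Zs) (f : SymAut Zs) :
  to_Out f = y -> Q_fun y = to_Out (Qhat f) :> Out Hkd.
Proof. by move=> fy; rewrite -(projT2 (cid (Q_subproof y)) f fy). Qed.

Lemma Q_morph : monoid_morphism Q_fun.
Proof.
split=> [|x y]; apply/val_inj => /=.
  by rewrite (@Q_funE 1 1) ?gmulf1.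
have [f fx] := symoutP x; have [g gy] := symoutP y.
rewrite (@Q_funE _ (f * g)); last by rewrite !gmulfM /= fx gy.
by rewrite !gmulfM /= (Q_funE fx) (Q_funE gy).
Qed.
HB.instance Definition _ :=
  isUMagmaMorphism.Build (SymOut Zs) (SymOut Zds) Q_fun Q_morph.

Definition Q : hom (SymOut Zs) (SymOut Zds) := Q_fun.

Lemma QE (y : SymOut Zs) (f : SymAut Zs) :
  to_Out f = y -> Q y = to_Out (Qhat f) :> Out Hkd.
Proof. exact: Q_funE. Qed.

End Reduction.

(* Main.v *)
(* Let F be the free group, H the free product of cyclic groups of order d and
   N the kernel of F -> H.  Let D be the Fox derivative of F with respect to the
   generator x_b, with coefficients in F_2[H]; it is additive on N.  If f is a
   symmetric automorphism inducing the identity on H, then f x_i is conjugate to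
   x_i or its inverse by some w whose image in H centralizes x_i, so D f = D on N
   (signs disappear mod 2).  Hence f |-> D f - D is a homomorphism from
   ker Qhat to an elementary abelian 2-group, where a finitely generated
   subgroup is finite.  On the automorphisms fixing all generators but x_a, and
   conjugating x_a by g^n x_b^d g^-n with g = x_c x_b, it takes pairwise distinct
   values, even modulo the values D (w u w^-1) - D u = (1 - u) D w of inner
   automorphisms with w in N: a finitely supported D w invariant under x_b and
   x_c vanishes, since these generate an infinite subgroup of H. *)
Require Import Defs.
From HB Require Import structures.
From mathcomp Require Import all_boot all_order all_algebra.
From mathcomp Require Import boolp classical_sets cardinality.

Set Implicit Arguments.
Unset Strict Implicit.
Unset Printing Implicit Defensive.

Local Open Scope classical_set_scope.
Local Open Scope group_scope.

Local Notation Z := (Algebra.to_multiplicative int).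
Local Notation hom G H := (UMagmaMorphism.type G H).

(** * An obstruction to finite generation *)

(* [rho] is a relation, and not a map, because an outer automorphism in the
   kernel has several lifts, whose Fox derivatives differ. *)
Section NotFinitelyGenerated.
Variables (G : groupType) (A : set G) (T : Type).
Variable rho : G -> (T -> bool) -> Prop.
Hypothesis rho1 : rho 1 (fun=> false).
Hypothesis rhoF : forall x y p q, rho x p -> rho y q ->
  rho (x / y) (fun t => p t (+) q t).
Hypothesis rhoA : forall x, A x -> exists p, rho x p.

(** The values on s generators have at most 2^s subset sums, and each element of [A] is related to
    one of these; infinitely many [x_ n] without common values do not fit. *)
Lemma not_finitely_generated (x_ : nat -> G) :
    (forall n, A (x_ n)) ->
    (forall m n p, rho (x_ m) p -> rho (x_ n) p -> m = n) ->
  ~ finitely_generated A.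
Proof.
move=> Ax x_inj [S /finite_seqP[s Ss] gS].
have sA x : x \in s -> A x.
  by move=> xs; rewrite -gS => B [_]; apply; rewrite Ss.
have /choice[q qP] : forall x, exists p, x \in s -> rho x p.
  move=> x; case: (boolP (x \in s)) => [xs|_]; last by exists (fun=> false).
  by have [p xp] := rhoA (sA _ xs); exists p.
pose sum (c : {ffun 'I_(size s) -> bool}) t :=
  \big[addb/false]_i (c i && q (tnth (in_tuple s) i) t).
have cover x : A x -> exists c, rho x (sum c).
  (* The elements related to some subset sum form a subgroup containing [S], hence all of
     [generated S]. *)
  rewrite -gS => /(_ [set x | exists c, rho x (sum c)]); apply; split; first split.
  - exists [ffun=> false]; have -> // : sum [ffun=> false] = fun=> false.
    by apply: funext => t; apply: big1 => i _; rewrite ffunE.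
  - move=> y z [c yc] [e ze]; exists [ffun i => c i (+) e i].
    have -> : sum [ffun i => c i (+) e i] = fun t => sum c t (+) sum e t.
      apply: funext => t; rewrite /sum -big_split; apply: eq_bigr => i _.
      by rewrite ffunE andb_addl.
    exact: rhoF.
  - move=> y; rewrite Ss => /= ys.
    have ys' : index y s < size s by rewrite index_mem.
    exists [ffun i => i == Ordinal ys'].
    have -> : sum [ffun i => i == Ordinal ys'] = q y; last exact: qP.
    apply: funext => t; rewrite /sum (bigD1 (Ordinal ys')) //= big1 ?addbF.
      by rewrite ffunE eqxx (tnth_nth y) /= nth_index.
    by move=> i /negbTE iy; rewrite ffunE iy.
have /choice[c cP] : forall n, exists c, rho (x_ n) (sum c).
  by move=> n; exact: cover.
have cI : injective c.
  by move=> m n cmn; apply: (x_inj _ _ (sum (c m))) => //; rewrite cmn.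
pose N := #|{ffun 'I_(size s) -> bool}|.
have := leq_card (fun i : 'I_N.+1 => c i) (inj_comp cI val_inj).
by rewrite card_ord ltnn.
Qed.

End NotFinitelyGenerated.

(** * Homomorphisms out of the infinite cyclic group *)

Lemma Z_posS n : Posz n.+1 = (Posz n : Z) * 1%Z.
Proof. by rewrite -addn1 PoszD. Qed.

Lemma Z_negS n : (- Posz n)%R = ((- Posz n.+1)%R : Z) * 1%Z.
Proof. by rewrite -addn1 PoszD GRing.opprD -[RHS]/(_ + _)%R GRing.subrK. Qed.

Section IntegerPowers.
Variable G : groupType.

Lemma int_hom_ext (f g : hom Z G) : f 1%Z = g 1%Z -> f =1 g.
Proof.
move=> fg; elim/int_ind => [|n IH|n IH].
- by rewrite -[0%R]/(1 : Z) !gmulf1.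
- by rewrite Z_posS !gmulfM IH fg.
- by apply: (mulIg (f 1%Z)); rewrite {2}fg -!gmulfM -Z_negS.
Qed.

Definition zpow (x : G) (z : Z) : G :=
  match z with Posz n => x ^+ n | Negz n => x ^- n.+1 end.

Lemma zpowS x (z : Z) : zpow x (z * 1%Z) = zpow x z * x.
Proof.
case: z => [n|n]; first by rewrite -Z_posS /= expgSr.
by rewrite NegzE -Z_negS -NegzE [in RHS]/= expgS invgM mulgVK; case: n => [|n];
  rewrite ?invg1.
Qed.

Lemma zpow_morph x : monoid_morphism (zpow x).
Proof.
split=> // y; elim/int_ind => [|n IH|n IH].
- by rewrite -[0%R]/(1 : Z) mulg1 [zpow x 1]/= mulg1.
- by rewrite Z_posS mulgA !zpowS IH mulgA.
- by apply: (mulIg x); rewrite -mulgA -!zpowS -mulgA -Z_negS.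
Qed.
HB.instance Definition _ x :=
  isUMagmaMorphism.Build Z G (zpow x) (zpow_morph x).

End IntegerPowers.

(* Unrestricted wreath product: functions of arbitrary support, on which [G]
   acts by left translation. *)
Definition wreath (G : groupType) := ((G -> bool) * G)%type.

Section Wreath.
Variable G : groupType.
HB.instance Definition _ := Choice.on (wreath G).

Definition wr_one : wreath G := (fun=> false, 1).
Definition wr_mul (x y : wreath G) : wreath G :=
  (fun g => x.1 g (+) y.1 (x.2^-1 * g), x.2 * y.2).
Definition wr_inv (x : wreath G) : wreath G := (fun g => x.1 (x.2 * g), x.2^-1).

Lemma wreathE (x y : wreath G) : x.1 =1 y.1 -> x.2 = y.2 -> x = y.
Proof. by case: x y => [p g] [q h] /= /funext-> ->. Qed.

Lemma wr_mulA : associative wr_mul.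
Proof.
move=> x y z; apply: wreathE => [g|] /=; last by rewrite mulgA.
by rewrite addbA invgM mulgA.
Qed.
Lemma wr_mul1 : left_id wr_one wr_mul.
Proof. by move=> x; apply: wreathE => [g|] /=; rewrite ?invg1 mul1g. Qed.
Lemma wr_mulr1 : right_id wr_one wr_mul.
Proof. by move=> x; apply: wreathE => [g|] /=; rewrite ?addbF ?mulg1. Qed.
Lemma wr_mulV : left_inverse wr_one wr_inv wr_mul.
Proof. by move=> x; apply: wreathE => [g|] /=; rewrite ?invgK ?addbb ?mulVg. Qed.
Lemma wr_mulrV : right_inverse wr_one wr_inv wr_mul.
Proof. by move=> x; apply: wreathE => [g|] /=; rewrite ?mulVKg ?addbb ?mulgV. Qed.
HB.instance Definition _ :=
  isGroup.Build (wreath G) wr_mulA wr_mul1 wr_mulr1 wr_mulV wr_mulrV.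

Lemma wreathM (x y : wreath G) g : (x * y).1 g = x.1 g (+) y.1 (x.2^-1 * g).
Proof. by []. Qed.

End Wreath.

(** * Reduced words and malnormality of the free factors *)

Section FreeProductWords.
Variables (I : finType) (L : I -> groupType).
Local Notation F := (freeprod L).
Implicit Types (u v w : F) (i j : I).

Lemma word_fpinj i (x : L i) : x != 1 -> word (fpinj i x) = [:: Tagged L x].
Proof. by rewrite /= /push /= => /negbTE->. Qed.

Lemma size_fpinj i (x : L i) : size (word (fpinj i x)) <= 1.
Proof. by rewrite /= /push /=; case: ifP. Qed.

Lemma size_push a s : size (push (L := L) a s) <= (size s).+1.
Proof.
rewrite /push; case: ifP => // _; case: s => //= b s.
by case: ifP => // _; case: ifP => //= _; rewrite ltnW.
Qed.

Lemma size_fpM u v : size (word (u * v)) <= size (word u) + size (word v).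
Proof.
rewrite -[word (u * v)]/(mulw u v); elim: (word u) => //= a s IH.
exact: leq_trans (size_push _ _) _.
Qed.

Lemma size_fpV u : size (word u^-1) = size (word u).
Proof. by rewrite -[word u^-1]/(invw u) /invw size_rev size_map. Qed.

Lemma mulw_cat (s t : seq {i : I & L i}) :
  reduced (s ++ t) -> mulw s t = s ++ t.
Proof.
elim: s => //= a s IH r.
by rewrite -/(mulw s t) IH ?push_reduced_cons // (reduced_cons r).
Qed.


Lemma reduced_rcons (s : seq {i : I & L i}) a : reduced (rcons s a) =
  [&& tagged a != 1, all (fun b : {i : I & L i} => tagged b != 1) s &
    sorted (fun b c : {i : I & L i} => tag b != tag c) (rcons s a)].
Proof. by rewrite /reduced all_rcons andbA. Qed.

Lemma reduced_cat_cons (s t : seq {i : I & L i}) a :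
  reduced (rcons s a) -> reduced (a :: t) -> reduced (s ++ a :: t).
Proof.
rewrite reduced_rcons /reduced all_cat => /and3P[_ -> sa] /andP[-> /= at_].
by case: s sa => //= b s; rewrite rcons_path cat_path /= => /andP[-> ->].
Qed.

Lemma size_inner v i (x : L i) :
    reduced (rcons (word v) (Tagged L x)) ->
  size (word (inner v (fpinj i x))) = (size (word v)).*2.+1.
Proof.
move=> vx.
have x1 : x != 1 by move: vx; rewrite reduced_rcons => /andP[].
(* This is the inverse of v x^-1, which is reduced because x and x^-1 lie in the same factor. *)
have xv : reduced (Tagged L x :: word v^-1).
  suff : reduced (invw (rcons (word v) (Tagged L x^-1))).
    by rewrite /invw map_rcons rev_rcons /invl /= invgK.
  apply: invw_reduced; move: vx; rewrite !reduced_rcons /= invg_eq1.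
  by case: (word v) => //= b s; rewrite !rcons_path.
have xvE : word (fpinj i x * v^-1) = Tagged L x :: word v^-1.
  by rewrite -[LHS]/(mulw (word (fpinj i x)) _) (word_fpinj x1) mulw_cat.
have -> : word (inner v (fpinj i x)) = word v ++ Tagged L x :: word v^-1.
  rewrite -mulw_cat ?reduced_cat_cons // -xvE.
  by rewrite -[RHS]/(word (v * (fpinj i x * v^-1))) mulgA.
by rewrite size_cat /= size_fpV addnS addnn.
Qed.

(** [z] is the last letter of [w] if that lies in the factor [i], and 1 otherwise; conjugating the
    factor by [v] then involves no cancellation. *)
Lemma fp_strip w i : exists v (z : L i), w = v * fpinj i z /\
  forall x : L i, x != 1 -> reduced (rcons (word v) (Tagged L x)).
Proof.
case: w => s; case/lastP: s => [|s [j y]] r.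
  exists 1, 1; split=> [|x x1]; first by rewrite gmulf1 mulg1; apply/val_inj.
  by rewrite reduced_rcons /= x1.
have := r; rewrite {1}reduced_rcons => /and3P[y1 As Ss].
have rs : reduced s.
  by rewrite /reduced As; case: (s) Ss => //= b t; rewrite rcons_path => /andP[].
case: (eqVneq j i) => [ji|ji]; last first.
  exists (FreeProd r), 1; split=> [|x x1]; first by rewrite gmulf1 mulg1.
  rewrite reduced_rcons x1 all_rcons y1 As /=.
  case: (s) Ss => [|b t] /=; first by rewrite ji.
  by rewrite !rcons_path last_rcons => ->.
subst j; exists (FreeProd rs), y; split=> [|x x1]; last first.
  rewrite /= reduced_rcons x1 As /=.
  by case: (s) Ss => //= b t; rewrite !rcons_path.
apply/val_inj; rewrite -[RHS]/(mulw s (word (fpinj i y))).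
by rewrite (word_fpinj y1) mulw_cat cats1.
Qed.

(** Once [w] is stripped to [v], the conjugate has length 2|v| + 1, while an element of the factor
    has length at most 1; so v = 1. *)
Lemma fpinj_malnormal w i (x y : L i) :
  x != 1 -> inner w (fpinj i x) = fpinj i y -> exists z, w = fpinj i z.
Proof.
move=> x1; have [v [z [-> vr]]] := fp_strip w i.
have x1' : z * x * z^-1 != 1.
  by apply: contra x1 => /eqP e; rewrite -(conjg_eq1 x z^-1) conjgE invgK mulgA e.
have -> : inner (v * fpinj i z) (fpinj i x) = inner v (fpinj i (z * x * z^-1)).
  by rewrite gmulfM /= !gmulfM gmulfV.
move=> /(congr1 (fun u => size (word u))); rewrite size_inner; last exact: vr.
move: (size_fpinj y) => + e; rewrite -e ltnS leqn0 double_eq0.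
move=> /eqP/size0nil v1; exists z.
have -> : v = 1 by exact/val_inj.
by rewrite mul1g.
Qed.

Lemma word_alternating i j (x : L i) (y : L j) n :
    i != j -> x != 1 -> y != 1 ->
  word ((fpinj i x * fpinj j y) ^+ n)
    = flatten (nseq n [:: Tagged L x; Tagged L y]).
Proof.
move=> ij x1 y1; elim: n => //= n IH; rewrite expgS -mulgA.
set u := _ ^+ n.
rewrite -[LHS]/(mulw (word (fpinj i x)) (mulw (word (fpinj j y)) u)).
rewrite (word_fpinj x1) (word_fpinj y1) {}/u IH /=.
have -> : forall s, push (Tagged L y) (flatten (nseq n [:: Tagged L x; s]))
    = Tagged L y :: flatten (nseq n [:: Tagged L x; s]).
  by case: n {IH} => [|n] s; rewrite /push /= (negbTE y1) // eq_sym (negbTE ij).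
by rewrite /push /= (negbTE x1) (negbTE ij).
Qed.

End FreeProductWords.

Lemma innerE (G : groupType) (x y : G) : inner x y = x * y * x^-1.
Proof. by []. Qed.

(** * Fox calculus modulo 2 over [H] *)

Section FoxDerivative.
Variables (k d : nat) (b : 'I_k).
Local Notation F := (Fk k).
Local Notation H := (Hkd k d).
Local Notation R := (reduction k d).
Implicit Types (u v w : F) (g h : H) (i : 'I_k).

(** Such an [f] factors through [R], by the universal property of the free product [H]. *)
Lemma reduction_ker_hom (G : groupType) (f : hom F G) :
    (forall i z, modd d z = 1 -> f (fpinj i z) = 1) ->
  forall u, R u = 1 -> f u = 1.
Proof.
move=> f1; have [r rK] := choice (@modd_surj d).
pose t i m := f (fpinj i (r m)).
have tE i z : t i (modd d z) = f (fpinj i z).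
  apply/divg1_eq; rewrite /t -!gmulfF; apply: f1.
  by rewrite gmulfF /= rK mulgV.
have tM i : monoid_morphism (t i).
  split=> [|x y].
    have <- : modd d 1 = 1 by rewrite gmulf1.
    by rewrite tE !gmulf1.
  have <- : modd d (r x * r y) = x * y by rewrite gmulfM /= !rK.
  by rewrite tE !gmulfM.
pose th i : hom _ G := HB.pack (t i) (isUMagmaMorphism.Build _ _ _ (tM i)).
have fE : fplift th \o R =1 f.
  apply: (@hom_ext _ _ _ (fplift th \o R)) => i z.
  by rewrite /= reduction_inj fplift_inj /= tE.
by move=> u u1; rewrite -fE /= u1 gmulf1.
Qed.

(** This gives the Magnus representation: the first component of a product in the wreath product
    obeys the Fox product rule. *)
Definition fox_gen i : wreath H :=
  (fun h => (i == b) && (h == 1), fpinj i (modd d 1%Z)).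

Definition fox : hom F (wreath H) :=
  fplift (fun i => zpow (fox_gen i) : hom Z (wreath H)).

(* The mod 2 reduction of the Fox derivative with respect to the generator of
   index [b], pushed forward to the group ring of [H]. *)
Definition fox_der u : H -> bool := (fox u).1.
Local Notation D := fox_der.

Lemma fox_fpinj i z : fox (fpinj i z) = zpow (fox_gen i) z.
Proof. exact: fplift_inj. Qed.

Lemma fox_snd u : (fox u).2 = R u.
Proof.
have sM : monoid_morphism (fun x : wreath H => x.2) by [].
pose s : hom (wreath H) H := HB.pack (fun x : wreath H => x.2)
  (isUMagmaMorphism.Build _ _ _ sM).
apply: (@hom_ext _ _ _ (s \o fox) R) => i.
pose x_i : hom Z F := (@fpinj _ (fun=> Z) i : hom (Z : groupType) F).
apply: (@int_hom_ext _ (s \o fox \o x_i : hom Z H) (R \o x_i : hom Z H)).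
by rewrite /= fox_fpinj reduction_inj.
Qed.

Lemma fox_derM u v h : D (u * v) h = D u h (+) D v ((R u)^-1 * h).
Proof. by rewrite /D gmulfM /= -fox_snd. Qed.

Lemma fox_der1 h : D 1 h = false.
Proof. by rewrite /D gmulf1. Qed.

Lemma fox_derV u h : D u^-1 ((R u)^-1 * h) = D u h.
Proof.
by have := fox_derM u u^-1 h; rewrite mulgV fox_der1; case: (D u h); case: (D _ _).
Qed.

(** The contributions of [w] and [w^-1] cancel because [R u = 1]; this is the equivariance of the
    relation module. *)
Lemma fox_der_inner w u h : R u = 1 -> D (inner w u) h = D u ((R w)^-1 * h).
Proof.
move=> u1; rewrite innerE !fox_derM gmulfM !u1 mulg1 fox_derV.
by rewrite addbC addbA addbb.
Qed.

(** The two terms in [D w] are the coboundary by which an inner automorphism trivial on [H] alters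
    [D]. *)
Lemma fox_der_inner_ker w u h : R w = 1 ->
  D (inner w u) h = D w h (+) D u h (+) D w ((R u)^-1 * h).
Proof.
move=> w1; rewrite innerE !fox_derM gmulfM !w1 invg1 !mul1g; congr (_ (+) _).
by rewrite -(fox_derV w) w1 invg1 mul1g.
Qed.

Lemma fox_der_fpinj i z h : D (fpinj i z) h -> i = b /\ exists x, h = fpinj i x.
Proof.
(* [P] cuts out a subgroup of the wreath product, so it passes from [fox_gen i] to all its
   powers. *)
pose P (x : wreath H) := (forall h, x.1 h -> i = b /\ exists y, h = fpinj i y) /\
  exists y, x.2 = fpinj i y.
have PM x y : P x -> P y -> P (x * y).
  move=> [Px [s xs]] [Py [t yt]]; split=> [g /=|]; last first.
    by exists (s * t); rewrite /= xs yt gmulfM.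
  case xg: (x.1 g) => yg; first exact: Px.
  have [ib [r yr]] := Py _ yg; split=> //; exists (s * r).
  by rewrite -[g](mulVKg x.2) yr xs gmulfM.
have PV x : P x -> P x^-1.
  move=> [Px [s xs]]; split=> [g /= /Px[ib [r xr]]|].
    by split=> //; exists (s^-1 * r); rewrite -[g](mulKg x.2) xr xs gmulfM gmulfV.
  by exists s^-1; rewrite /= xs gmulfV.
have P1 : P 1 by split=> //; exists 1; rewrite gmulf1.
have Pe : P (fox_gen i).
  split=> [g /andP[/eqP ib /eqP ->]|]; last by exists (modd d 1%Z).
  by split=> //; exists 1; rewrite gmulf1.
have PX n : P (fox_gen i ^+ n) by elim: n => // n IH; rewrite expgS; apply: PM.
suff [+ _] : P (fox (fpinj i z)) by apply.
by rewrite fox_fpinj; case: z => n; [exact: PX|apply: PV; exact: PX].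
Qed.

(** A length bound stands in for finite support; by the product rule each letter raises it by at
    most one. *)
Lemma fox_der_bounded u : exists B, forall h, D u h -> size (word h) <= B.
Proof.
rewrite [u]freeprodE; elim: (word u) => [|[i z] s [B IH]].
  by exists 0 => h; rewrite big_nil fox_der1.
rewrite big_cons; exists B.+1 => h; rewrite fox_derM /=.
case zh: (D (fpinj i z) h) => hB.
  by have [_ [x ->]] := fox_der_fpinj zh; apply: leq_trans (size_fpinj _) _.
rewrite -[h](mulVKg (R (fpinj i z))); apply: leq_trans (size_fpM _ _) _.
apply: (@leq_add _ _ 1 B); last exact: IH.
by rewrite reduction_inj size_fpinj.
Qed.


(** The derivative of x_b^d is 1 + x_b + ... + x_b^(d-1), whose terms are distinct in [H]. *)
Lemma fox_der_period (hd : 1 < d) : D (fpinj b (Posz d : Z)) 1.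
Proof.
rewrite /D fox_fpinj -[zpow _ _]/(fox_gen b ^+ d).
have fox2 n : (fox_gen b ^+ n).2 = fpinj b (modd d (Posz n : Z)).
  by rewrite -[_ ^+ n]/(zpow (fox_gen b) n) -fox_fpinj fox_snd reduction_inj.
suff : forall n, n < d -> (fox_gen b ^+ n.+1).1 1.
  by move/(_ d.-1); rewrite prednK ?(ltnW hd) //; apply.
elim=> [|n IH] nd; first by rewrite expg1 /= !eqxx.
rewrite expgSr wreathM IH ?(ltnW nd) // mulg1 fox2.
rewrite [(fox_gen b).1]/= eqxx /=.
rewrite invg_eq1 gmulf_eq1; last exact: fpinj_inj.
apply/negP => /eqP; rewrite Zp_nat.
move/(congr1 val) => /=.
by rewrite Zp_cast // modn_small.
Qed.

End FoxDerivative.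

(** * Kernel automorphisms and their effect on Fox derivatives *)

Section Kernel.
Variables (k d : nat) (hd : 1 < d).
Local Notation F := (Fk k).
Local Notation H := (Hkd k d).
Local Notation R := (reduction k d).
Local Notation Zs := (fun _ : 'I_k => Z : groupType).
Local Notation Zds := (fun _ : 'I_k => Algebra.to_multiplicative 'Z_d : groupType).
Local Notation x_ := (@fpinj 'I_k Zs).
Implicit Types (u v w : F) (h : H) (i : 'I_k) (f g : SymAut Zs).

Lemma modd1_neq1 : modd d 1%Z != 1.
Proof.
apply/eqP => /(congr1 val) /=.
by rewrite modn_small.
Qed.

Lemma Qhat_kernelP f : kernel (Qhat k d) f <-> forall u, R (f u) = R u.
Proof.
split=> [f1 u|fR]; first by rewrite -QhatE [Qhat k d f]f1.
exact: Qhat_uniq.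
Qed.

Lemma reduction_centralizer w i z :
  R (inner w (x_ i 1%Z)) = R (x_ i z) -> exists c, R w = fpinj i c.
Proof.
rewrite reduction_inner !reduction_inj.
exact: (@fpinj_malnormal _ Zds _ i _ _ modd1_neq1).
Qed.

(** Acting trivially on [H] forces j = i, surjectivity onto the conjugate of the factor makes the
    exponent [y] a unit of the integers, and malnormality confines [R w] to the factor. *)
Lemma kernel_fpinj f i : (forall u, R (f u) = R u) ->
  exists w, (exists c, R w = fpinj i c) /\
    ((forall z, f (x_ i z) = inner w (x_ i z)) \/
     (forall z, f (x_ i z) = inner w (x_ i z)^-1)).
Proof.
move=> fR; have [j [w e]] := symautP f i.
have [y fy] : exists y, f (x_ i 1%Z) = inner w (x_ j y).
  have : (f @` range (x_ i)) (f (x_ i 1%Z)) by exists (x_ i 1%Z) => //; exists 1%Z.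
  by rewrite e => -[_ [y _ <-] <-]; exists y.
have [z fz] : exists z, f (x_ i z) = inner w (x_ j 1%Z).
  have : (inner w @` range (x_ j)) (inner w (x_ j 1%Z)).
    by exists (x_ j 1%Z) => //; exists 1%Z.
  by rewrite -e => -[_ [z _ <-] <-]; exists z.
have ij : i = j.
  apply: (@fpinj_conj _ _ i j (modd d 1%Z) (modd d y) 1 (R w) _ modd1_neq1).
  rewrite -(reduction_inj d (i := j)) -reduction_inner -fy fR reduction_inj.
  by rewrite innerE mul1g invg1 mulg1.
subst j; exists w.
pose my (t : Z) : Z := GRing.mul (y : int) t.
have mM : monoid_morphism my.
  by split=> [|s t]; [exact: GRing.mulr0 | exact: GRing.mulrDr].
pose m : hom Z Z := HB.pack my (isUMagmaMorphism.Build Z Z _ mM).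
have fE t : f (x_ i t) = inner w (x_ i (GRing.mul (y : int) t)).
  pose xi : hom Z F := (x_ i : hom (Z : groupType) F).
  pose p : hom Z F := aut_val f \o xi.
  pose q : hom Z F := aut_val (inner w) \o xi \o m.
  apply: (@int_hom_ext _ p q); rewrite -[LHS]/(f (x_ i 1%Z)) fy.
  by rewrite -[RHS]/(inner w (x_ i (my 1%Z))) /my GRing.mulr1.
have yz : GRing.mul (y : int) z = 1%Z.
  move: fz; rewrite fE => /(can_inj (innerK w)).
  exact: fpinj_inj.
split; first by apply: (@reduction_centralizer w i z); rewrite -fz fR.
have : `|y|%N = 1%N.
  by have /eqP := congr1 absz yz; rewrite abszM muln_eq1 => /andP[/eqP].
case: y {fy yz my mM m} fE => [[|[|n]]|[|n]] //= fE _; [left|right] => t.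
  by rewrite fE GRing.mul1r.
by rewrite fE GRing.mulN1r -gmulfV.
Qed.

(** The sum of [D f] and [D] is again a derivation over [R], so it vanishes on the kernel of [R]
    once it vanishes on the x_i^z with z = 0 mod d. *)
Lemma fox_der_kernel b f n : (forall u, R (f u) = R u) -> R n = 1 ->
  @fox_der k d b (f n) =1 @fox_der k d b n.
Proof.
move=> fR; pose D := @fox_der k d b.
pose g u : wreath H := (fun h => D (f u) h (+) D u h, R u).
have gM : monoid_morphism g.
  split=> [|u v]; apply: wreathE => [h|].
  - by rewrite /= !gmulf1 /D fox_der1.
  - by rewrite /= gmulf1.
  - by rewrite wreathM /= gmulfM /D !fox_derM fR addbACA.
  - by rewrite /= gmulfM.
pose gh : hom F (wreath H) := HB.pack g (isUMagmaMorphism.Build _ _ _ gM).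
suff gh1 : forall i z, modd d z = 1 -> gh (x_ i z) = 1.
  move=> /(reduction_ker_hom gh1)/(congr1 fst) nE h.
  have /negbT := congr1 (fun p => p h) nE.
  by rewrite /= negb_add => /eqP.
move=> i z z1; apply: wreathE => [h|]; last by rewrite /= reduction_inj z1 gmulf1.
have [w [[c wc] fE]] := kernel_fpinj i fR; have [r rc] := modd_surj c.
(* Only [R w] matters here, so [w] may be replaced by x_i^r, which commutes with x_i^t. *)
have Dw t h' : modd d t = 1 -> D (inner w (x_ i t)) h' = D (x_ i t) h'.
  move=> t1; have xt1 : R (x_ i t) = 1 by rewrite reduction_inj t1 gmulf1.
  have wE : R w = R (x_ i r) by rewrite wc -rc reduction_inj.
  rewrite /D fox_der_inner // wE -fox_der_inner // innerE -gmulfV -!gmulfM.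
  rewrite -[r * t]/(GRing.add (r : int) t) GRing.addrC.
  by rewrite -[GRing.add _ _]/(t * r) mulgK.
have xz1 : R (x_ i z) = 1 by rewrite reduction_inj z1 gmulf1.
rewrite -[LHS]/(D (f (x_ i z)) h (+) D (x_ i z) h).
case: fE => ->; first by rewrite Dw ?addbb.
have zV1 : modd d z^-1 = 1 by rewrite gmulfV /= z1 invg1.
rewrite -[(x_ i z)^-1](gmulfV (x_ i)) Dw // gmulfV.
by have := fox_derV b (x_ i z) h; rewrite xz1 invg1 mul1g /D => ->; rewrite addbb.
Qed.

(** Writing g u = n u with [R n = 1], [f] does not change [D n]; this makes D f - D additive under
    composition. *)
Lemma fox_der_comp b f g u h :
    (forall v, R (f v) = R v) -> (forall v, R (g v) = R v) ->
  @fox_der k d b (f (g u)) h =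
    @fox_der k d b (f u) h (+) @fox_der k d b (g u) h (+) @fox_der k d b u h.
Proof.
move=> fR gR; have n1 : R (g u / u) = 1 by rewrite gmulfF gR mulgV.
have : g u = (g u / u) * u by rewrite mulgVK.
move: (g u / u) n1 => n n1 ->.
have -> : f (n * u) = f n * f u by rewrite gmulfM.
rewrite !fox_derM fR n1 invg1 !mul1g fox_der_kernel //.
by rewrite addbCA -!addbA addbb addbF.
Qed.

(** * Partial conjugations *)

Definition pconj (a : 'I_k) u : hom F F :=
  fplift (fun i => inner (if i == a then u else 1) \o x_ i
    : hom (Z : groupType) F).

Lemma pconj_fpinj a u i z :
  pconj a u (x_ i z) = inner (if i == a then u else 1) (x_ i z).
Proof. exact: fplift_inj. Qed.

Lemma pconj_id a u i z : i != a -> pconj a u (x_ i z) = x_ i z.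
Proof. by rewrite pconj_fpinj => /negbTE->; rewrite innerE mul1g invg1 mulg1. Qed.

Lemma pconjK a u : (forall v, pconj a v u = u) ->
  cancel (pconj a u) (pconj a u^-1).
Proof.
move=> u_fix x; rewrite -[RHS]/(idfun x).
apply: (@hom_ext _ _ _ (pconj a u^-1 \o pconj a u) (idfun : hom F F)) => i z.
rewrite -[LHS]/(pconj a u^-1 (pconj a u (x_ i z))) pconj_fpinj.
case: (eqVneq i a) => [->|ia].
  rewrite innerE !gmulfM gmulfV !u_fix pconj_fpinj eqxx.
  by rewrite innerE invgK !mulgA mulgV mul1g mulgK.
by rewrite innerE mul1g invg1 mulg1 pconj_id.
Qed.

Lemma pconj_symaut a u : (forall v, pconj a v u = u) ->
  exists f, forall v, f v = pconj a u v.
Proof.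
move=> u_fix.
have fa : automorphism (pconj a u).
  split; first by split=> [|v w]; rewrite ?gmulf1 ?gmulfM.
  exists (pconj a u^-1); first exact: pconjK.
  rewrite -{2}[u]invgK; apply: pconjK => v.
  by rewrite gmulfV u_fix.
have fs : symmetric_aut (MkAut (asboolT fa)).
  move=> i; exists i, (if i == a then u else 1).
  by apply: eq_imagel => _ [z _ <-]; exact: pconj_fpinj.
by exists (MkSymAut (asboolT fs)).
Qed.

Lemma reduction_pconj a u v : R u = 1 -> R (pconj a u v) = R v.
Proof.
move=> u1; apply: (@hom_ext _ _ _ (R \o pconj a u) R) => i z.
rewrite -[LHS]/(R (pconj a u (x_ i z))) pconj_fpinj reduction_inner.
by case: ifP => _; rewrite ?u1 ?[R 1]gmulf1 innerE mul1g invg1 mulg1.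
Qed.

(** * Separating a family of partial conjugations *)

Variables (a b c : 'I_k).
Hypotheses (ba : b != a) (ca : c != a) (cb : c != b).
Local Notation D := (@fox_der k d b).

(** It avoids x_a, and its powers have unbounded length in [H], so the derivatives of the
    [drift_conj n] live on distinct cosets of the factor [b]. *)
Definition drift : F := x_ c 1%Z * x_ b 1%Z.
Definition drift_conj n : F := inner (drift ^+ n) (x_ b (Posz d)).

Lemma drift_conj_fix n v : pconj a v (drift_conj n) = drift_conj n.
Proof.
have dv : pconj a v drift = drift by rewrite /drift gmulfM pconj_id ?pconj_id.
have dn : pconj a v (drift ^+ n) = drift ^+ n by rewrite gmulfXn dv.
by rewrite /drift_conj innerE !gmulfM gmulfV !dn pconj_id.
Qed.

Lemma modd_d : modd d (Posz d) = 1.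
Proof.
rewrite -[LHS]/(d%:R : 'Z_d)%R Zp_nat; apply/val_inj.
by rewrite /= Zp_cast // modnn.
Qed.

Lemma reduction_drift_conj n : R (drift_conj n) = 1.
Proof.
by rewrite reduction_inner reduction_inj modd_d !gmulf1.
Qed.

Lemma size_drift n : size (word (R drift ^+ n)) = n.*2.
Proof.
rewrite gmulfM !reduction_inj (@word_alternating _ Zds) ?modd1_neq1 //.
by elim: n => //= n ->.
Qed.

Lemma fox_der_drift_conj n h :
  D (drift_conj n) h = D (x_ b (Posz d)) ((R drift ^+ n)^-1 * h).
Proof. by rewrite fox_der_inner ?gmulfXn // reduction_inj modd_d gmulf1. Qed.

Lemma bounded_invariant_fox w h :
    (forall y, D w ((R (x_ b 1%Z))^-1 * y) = D w y) ->
    (forall y, D w ((R (x_ c 1%Z))^-1 * y) = D w y) ->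
  D w h = false.
Proof.
move=> wb wc; apply/negbTE/negP => wh.
have [B wB] := fox_der_bounded d b w.
have w_inv n : D w (R drift ^+ n * h).
  elim: n => [|n IH]; first by rewrite mul1g.
  have dE : R drift = R (x_ c 1%Z) * R (x_ b 1%Z) by rewrite gmulfM.
  by rewrite expgS dE -!mulgA -wc mulKg -wb mulKg -dE.
(* As [R drift ^+ n] has length 2n, cancelling [h] would give 2n <= B + |h|, which this [n]
   violates. *)
pose n := (B + size (word h)).+1.
have := size_fpM (R drift ^+ n * h) h^-1; rewrite mulgK size_drift size_fpV.
move=> /leq_trans/(_ (leq_add (wB _ (w_inv n)) (leqnn _))).
by rewrite -addnn /n leqNgt ltnS leq_addr.
Qed.

(** On the kernel of [R] the derivative is additive, so the corrections by [w] and [w'] merge into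
    one coboundary, that of [D (w * w')]. *)
Lemma fox_der_coboundary w w' u v v' h :
    R w = 1 -> R w' = 1 -> R v = R u -> R v' = R u ->
    D (inner w v) h = D (inner w' v') h ->
  D (w * w') ((R u)^-1 * h) = D (w * w') h (+) D v h (+) D v' h.
Proof.
move=> w1 w1' vu vu'; rewrite !fox_der_inner_ker // !fox_derM w1 invg1 !mul1g vu vu'.
by do 6!case: (D _ _).
Qed.

Lemma drift_conj_separated m n w w' :
    R w = 1 -> R w' = 1 -> m < n ->
  ~ (forall u, D (inner w (pconj a (drift_conj m) u))
     =1 D (inner w' (pconj a (drift_conj n) u))).
Proof.
move=> w1 w1' mn e.
have Rp j u : R (pconj a (drift_conj j) u) = R u.
  exact/reduction_pconj/reduction_drift_conj.
have cob u y := fox_der_coboundary w1 w1' (Rp m u) (Rp n u) (e u y).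
(* The partial conjugations fix x_b and x_c, where the coboundary relation becomes invariance of
   [D (w * w')]. *)
have ww0 y : D (w * w') y = false.
  by apply: bounded_invariant_fox => h; rewrite cob !pconj_id // addbK.
(* Since [D (w * w')] vanishes, the relation at x_a says that x_a fixes [psi]; yet [psi] is true at
   drift^n and false at x_a^-1 drift^n. *)
pose psi y := D (drift_conj m) y (+) D (drift_conj n) y.
have psi_inv y : psi ((R (x_ a 1%Z))^-1 * y) = psi y.
  have := cob (x_ a 1%Z) y; rewrite !ww0 !pconj_fpinj eqxx.
  have Dp j := fox_der_inner_ker b (x_ a 1%Z) y (reduction_drift_conj j).
  rewrite !Dp /psi.
  by do 5!case: (D _ _).
(* The support lies in drift^j times the factor [b], and drift^i has length 2i > 1 for i > 0. *)
have Dj (j i : nat) : D (drift_conj j) (R drift ^+ (j + i)) = (i == 0)%N.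
  rewrite fox_der_drift_conj expgnDr mulKg.
  case: i => [|i]; first exact: fox_der_period.
  apply/negP => /fox_der_fpinj[_ [x /(congr1 (fun y => size (word y)))]].
  by rewrite size_drift => xs; have := @size_fpinj _ Zds b x; rewrite -xs.
have := psi_inv (R drift ^+ n); rewrite {2}/psi.
have := Dj n 0%N; rewrite addn0 => ->.
have := Dj m (n - m)%N; rewrite subnKC ?(ltnW mn) // subn_eq0 leqNgt mn => ->.
(* Projecting [H] to the factor [a] kills x_b and drift but not x_a, so x_a^-1 drift^n lies outside
   these supports. *)
pose p i (z : Algebra.to_multiplicative 'Z_d) : Algebra.to_multiplicative 'Z_d :=
  if i == a then z else 1.
have pM i : monoid_morphism (p i).
  by split=> [|x y]; rewrite /p; case: (i == a); rewrite ?mulg1.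
pose ph i : hom (Algebra.to_multiplicative 'Z_d) (Algebra.to_multiplicative 'Z_d) :=
  HB.pack (p i) (isUMagmaMorphism.Build _ _ _ (pM i)).
pose pr := fplift ph : hom H _.
have Dj0 j : D (drift_conj j) ((R (x_ a 1%Z))^-1 * R drift ^+ n) = false.
  apply/negP; rewrite fox_der_drift_conj => /fox_der_fpinj[_ [x /(congr1 pr)]].
  have prE i z : pr (R (x_ i z)) = p i (modd d z).
    by rewrite reduction_inj; exact: fplift_inj.
  have prd l : pr (R drift ^+ l) = 1.
    have -> : R drift = R (x_ c 1%Z) * R (x_ b 1%Z) by rewrite gmulfM.
    by rewrite gmulfXn gmulfM !prE /p (negbTE ca) (negbTE ba) mulg1 expg1n.
  have -> : pr (fpinj b x) = 1.
    by apply: etrans (@fplift_inj _ Zds _ ph b x) _; rewrite /= /p (negbTE ba).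
  have prM s t : pr (s * t) = pr s * pr t by exact: gmulfM.
  have prV s : pr s^-1 = (pr s)^-1 by exact: gmulfV.
  rewrite !prM !prV !prd prE invg1 mul1g mulg1 /p eqxx => /eqP.
  by rewrite invg_eq1 (negbTE modd1_neq1).
by rewrite /psi !Dj0.
Qed.

(** * The homomorphism D f - D on the kernel *)

Definition fox_jump f (t : F * H) := D (f t.1) t.2 (+) D t.1 t.2.

Lemma fox_jump1 : fox_jump 1 = fun=> false.
Proof. by apply: funext => t; exact: addbb. Qed.

Lemma fox_jumpF f g : kernel (Qhat k d) f -> kernel (Qhat k d) g ->
  fox_jump (f / g) = fun t => fox_jump f t (+) fox_jump g t.
Proof.
move=> /Qhat_kernelP fR g1.
have /Qhat_kernelP gR := g1.
have /Qhat_kernelP gVR : kernel (Qhat k d) g^-1.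
  by rewrite /kernel /= gmulfV g1 invg1.
pose g' : SymAut Zs := g^-1.
have gg' u : g (g' u) = u by rewrite -[LHS]/((g * g^-1 : SymAut Zs) u) mulgV.
apply: funext => -[u h].
(* The relation for g g^-1 = 1 expresses the jump of g^-1 by that of [g]. *)
have := fox_der_comp b u h gR gVR; rewrite gg'.
rewrite -[fox_jump (f / g) _]/(D (f (g' u)) h (+) D u h) (fox_der_comp b u h fR gVR).
rewrite /fox_jump /= -/g'.
by case: (D (f u) h); case: (D (g u) h); case: (D (g' u) h); case: (D u h).
Qed.

(** [R w] centralizes the images of x_a and x_b, hence lies in two different factors. *)
Lemma kernel_inner w f g : kernel (Qhat k d) f -> kernel (Qhat k d) g ->
  (forall u, f u = inner w (g u)) -> R w = 1.
Proof.
move=> /Qhat_kernelP fR /Qhat_kernelP gR fg.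
have wR i : R (inner w (x_ i 1%Z)) = R (x_ i 1%Z).
  by rewrite reduction_inner -{1}(gR (x_ i 1%Z)) -reduction_inner -fg fR.
have [s ws] := reduction_centralizer (wR a).
have [t wt] := reduction_centralizer (wR b).
have [s1|s1] := eqVneq s 1; first by rewrite ws s1 gmulf1.
have st : inner 1 (fpinj a s) = inner 1 (fpinj b t) by rewrite -ws -wt.
by have := fpinj_conj st s1 => ab; move: ba; rewrite ab eqxx.
Qed.

(** A symmetric lift of [y] induces an inner automorphism of [H]; a preimage [w] of the conjugating
    element allows undoing it in [F]. *)
Lemma kernel_Q_lift (y : SymOut Zs) : kernel (Q k d) y ->
  exists2 f, kernel (Qhat k d) f & to_Out f = y.
Proof.
move=> y1; have [g gy] := symoutP y.
have : to_Out (Qhat k d g) == to_Out 1.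
  by rewrite -(QE d gy) [Q k d y]y1 !gmulf1.
move=> /to_OutP[v gv]; have [w wv] := reduction_surj v.
have iw : symmetric_aut (inner w^-1 : Aut F) by move=> i; exists i, w^-1.
exists (MkSymAut (asboolT iw) * g).
  apply/Qhat_kernelP => u.
  rewrite -[LHS]/(R (inner w^-1 (g u))) reduction_inner -QhatE gv.
  by rewrite mulg1 -wv gmulfV innerK.
by rewrite -gy; apply/eqP/to_OutP; exists w^-1.
Qed.

Lemma drift_auts : exists f_ : nat -> SymAut Zs, forall n,
  kernel (Qhat k d) (f_ n) /\ forall u, f_ n u = pconj a (drift_conj n) u.
Proof.
have /choice[f_ fE] n := pconj_symaut (drift_conj_fix n).
exists f_ => n; split; last exact: fE.
by apply/Qhat_kernelP => u; rewrite fE reduction_pconj // reduction_drift_conj.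
Qed.

(** Allowing inner factors serves both kernels: w = w' = 1 for [Qhat], arbitrary lifts of outer
    classes for [Q]. *)
Lemma fox_jump_separated m n f f' g g' w w' :
    kernel (Qhat k d) f -> kernel (Qhat k d) f' ->
    kernel (Qhat k d) g -> kernel (Qhat k d) g' ->
    (forall u, g u = pconj a (drift_conj m) u) ->
    (forall u, g' u = pconj a (drift_conj n) u) ->
    (forall u, f u = inner w (g u)) -> (forall u, f' u = inner w' (g' u)) ->
    fox_jump f = fox_jump f' -> m = n.
Proof.
move=> fK fK' gK gK' gE gE' fg fg' e.
have w1 := kernel_inner fK gK fg; have w1' := kernel_inner fK' gK' fg'.
have De u : D (inner w (pconj a (drift_conj m) u))
    =1 D (inner w' (pconj a (drift_conj n) u)).
  move=> h; rewrite -gE -gE' -fg -fg'.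
  by have /(congr1 (fun p => p (u, h)))/addIb := e.
have De' u : D (inner w' (pconj a (drift_conj n) u))
    =1 D (inner w (pconj a (drift_conj m) u)) by move=> h; rewrite De.
case: (ltngtP m n) => // mn.
  by have := drift_conj_separated w1 w1' mn De.
by have := drift_conj_separated w1' w1 mn De'.
Qed.

(** * Infinite generation of both kernels *)

Lemma kernel_Qhat_not_fg : ~ finitely_generated (kernel (Qhat k d)).
Proof.
have [f_ fP] := drift_auts.
pose rho f p := kernel (Qhat k d) f /\ fox_jump f = p.
apply: (@not_finitely_generated _ _ _ rho _ _ _ f_) => [|x y p q||n|m n p].
- by split; [exact: gmulf1|exact: fox_jump1].
- move=> [xK <-] [yK <-]; split; last by rewrite fox_jumpF.
  by rewrite /kernel /= gmulfF xK yK mulgV.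
- by move=> x xK; exists (fox_jump x).
- exact: (fP n).1.
- move=> [mK pm] [nK pn].
  apply: (fox_jump_separated mK nK mK nK (fP m).2 (fP n).2 (w := 1) (w' := 1));
    last by rewrite pm pn.
    by move=> u; rewrite gmulf1.
  by move=> u; rewrite gmulf1.
Qed.

Lemma kernel_Q_not_fg : ~ finitely_generated (kernel (Q k d)).
Proof.
have [f_ fP] := drift_auts.
have so n : symmetric_out (to_Out (f_ n)) by exists (f_ n).
pose y_ n : SymOut Zs := MkSymOut (asboolT (so n)).
pose rho (y : SymOut Zs) p :=
  exists f, [/\ kernel (Qhat k d) f, to_Out f = y & fox_jump f = p].
apply: (@not_finitely_generated _ _ _ rho _ _ _ y_) => [|x y p q||n|m n p].
- by exists 1; split; [exact: gmulf1|rewrite !gmulf1|exact: fox_jump1].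
- move=> [f [fK fx <-]] [g [gK gy <-]]; exists (f / g); split.
  + by rewrite /kernel /= gmulfF fK gK mulgV.
  + transitivity (to_Out f / to_Out g); first by rewrite !gmulfF.
    by rewrite fx gy gmulfF.
  + by rewrite fox_jumpF.
- by move=> y /kernel_Q_lift[f fK fy]; exists (fox_jump f), f.
- by apply/val_inj; rewrite /= (QE d (f := f_ n)) // (fP n).1 !gmulf1.
- move=> [f [fK /eqP/to_OutP[w fw] fp]] [g [gK /eqP/to_OutP[v gv] gp]].
  apply: (fox_jump_separated fK gK (fP m).1 (fP n).1 (fP m).2 (fP n).2
    (w := w) (w' := v)); last by rewrite fp gp.
    by move=> u; rewrite fw.
  by move=> u; rewrite gv.
Qed.

End Kernel.

Theorem theorem4 (k d : nat) (hk : (3 <= k)%N) (hd : (2 <= d)%N) :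
  ~ finitely_generated (kernel (Qhat k d)) /\
  ~ finitely_generated (kernel (Q k d)).
Proof.
(* Here k >= 3 enters: one generator to be conjugated, two others to generate an infinite subgroup
   of [H]. *)
pose a : 'I_k := Ordinal (ltnW (ltnW hk)).
pose b : 'I_k := Ordinal (ltnW hk).
pose c : 'I_k := Ordinal hk.
split; first exact: (@kernel_Qhat_not_fg _ _ hd a b c).
exact: (@kernel_Q_not_fg _ _ hd a b c).
Qed.
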